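(* Let $p$ be a prime and $m\geq 2$ an integer, and let $U$, $D$ and $\mathcal{N}$ be as defined in the context. (i) Let $P$ be a non-abelian exponent-critical $p$-group of exponent $p^m$ and type $\mathcal{A}$. Then $P\cong U/N$ for some $N\in\mathcal{N}$. (ii) For every $N\in\mathcal{N}$, the group $U/N$ is a non-abelian exponent-critical $p$-group of exponent $p^m$. (iii) There are no non-abelian exponent-critical $2$-groups of exponent $2^2$ and type $\mathcal{A}$. When $p$ is odd or $m\geq 3$, every group of the form $U/N$ with $N\in\mathcal{N}$ is an exponent-critical $p$-group of exponent $p^m$ and type $\mathcal{A}$.
   Context: A finite group $G$ is exponent-critical if $\exp(G)$ is not the least common multiple of the exponents of the proper non-abelian subgroups of $G$. An exponent-critical $p$-group is of type $\mathcal{A}$ if it has exactly one abelian maximal subgroup. Construction: let $W=\langle a_0\rangle\times\langle a_1\rangle\times\cdots\times\langle a_{p-1}\rangle$ be abelian, where $a_0$ has order $p^m$ and $a_i$ has order $p^{m-1}$ for $1\le i\le p-1$. Let $\phi$ be the automorphism of $W$ with $\phi(a_i)=a_ia_{i+1}$ for $0\le i\le p-2$ and $\phi(a_{p-1})=a_{p-1}\prod_{j=1}^{p-1}a_j^{-\binom{p}{j}}$ (this automorphism has order $p$). Let $b_0$ generate a cyclic group of order $p^{m-1}$ and let $U=W\rtimes\langle b_0\rangle$ with $b_0^{-1}wb_0=\phi(w)$ for $w\in W$. Let $D$ be the normal subgroup of $U$ of order $p$ generated by $a_0^{p^{m-1}}a_{p-1}^{p^{m-2}}$. Let $\mathcal{N}$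 be the set of normal subgroups $N$ of $U$ such that $D\le N\le\Phi(U)$, $N\cap\langle a_0\rangle=\{1\}$, and $U'\not\le N$. *)

(* Defs.v *)
From HB Require Import structures.
From mathcomp Require Import all_boot all_fingroup all_solvable.
Set Implicit Arguments. Unset Strict Implicit. Unset Printing Implicit Defensive.
Local Open Scope group_scope.

Definition lcm_exp_nonab (gT : finGroupType) (G : {set gT}) : nat :=
  \big[lcmn/1%N]_(H : {group gT} | (H \proper G) && ~~ abelian H) exponent H.

Definition exp_critical (gT : finGroupType) (G : {set gT}) : bool :=
  exponent G != lcm_exp_nonab G.

Definition typeA (gT : finGroupType) (G : {set gT}) : bool :=
  #|[set M : {group gT} | maximal M G & abelian M]| == 1%N.

(* (U, W, a, b0) realises the construction of the paper:
   W = <a_0> x ... x <a_{p-1}>, |a_0| = p^m, |a_i| = p^(m-1) (1 <= i <= p-1),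
   U = W ><| <b0>, |b0| = p^(m-1), and b0^-1 w b0 = phi(w)
   (in MathComp, x ^ y = y^-1 * x * y). *)
Definition is_U (p m : nat) (gT : finGroupType) (U W : {set gT})
    (a : nat -> gT) (b0 : gT) : Prop :=
  [/\ \big[dprod/1]_(i < p) <[a i]> = W,
      #[a 0%N] = (p ^ m)%N,
      (forall i, 1 <= i < p -> #[a i] = (p ^ m.-1)%N) &
      #[b0] = (p ^ m.-1)%N] /\
  [/\
      W ><| <[b0]> = U,
      (forall i, i.+1 < p -> a i ^ b0 = a i * a i.+1) &
      a p.-1 ^ b0 = a p.-1 * (\prod_(1 <= j < p) (a j ^+ 'C(p, j))^-1)].

Definition D_of (p m : nat) (gT : finGroupType) (a : nat -> gT) : {set gT} :=
  <[a 0%N ^+ (p ^ m.-1) * a p.-1 ^+ (p ^ m.-2)]>.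

Definition in_calN (p m : nat) (gT : finGroupType) (U : {set gT})
    (a : nat -> gT) (N : {set gT}) : bool :=
  [&& N <| U, D_of p m a \subset N, N \subset 'Phi(U),
      N :&: <[a 0%N]> == 1 & ~~ (U^`(1) \subset N)].

(* Main.v *)
(* A type A critical group P of exponent p^m has all elements of order p^m in
   its abelian maximal subgroup A and in no other maximal subgroup, so P is
   generated by any x of order p^m and any b outside A.  With y_0 = x and
   y_(i+1) = [y_i, b], the fact that b^p centralises A is exactly the relation
   defining phi(a_(p-1)), so a_i |-> y_i, b0 |-> b extends to a morphism from U
   onto P.  Elements outside A have order dividing p^(m-1), and expanding
   (b x)^p = b^p x^(1 + phi + ... + phi^(p-1)) in terms of the y_i shows that
   (b x)^(p^(m-1)) = 1 says precisely that D lies in the kernel.  Conversely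
   the same expansion shows that modulo D every element of U outside
   A0 = W <b0^p> has order dividing p^(m-1), while a second abelian maximal
   subgroup of U / N would put [U', b0] inside N, hence also a_0^(p^(m-1))
   when p is odd or m >= 3. *)
Require Import Defs.
From mathcomp Require Import all_boot all_fingroup all_solvable.
Set Implicit Arguments. Unset Strict Implicit. Unset Printing Implicit Defensive.
Local Open Scope group_scope.

(** * Iterated commutators and binomial expansions over an abelian normalised subgroup *)

Section CommSeq.

Variables (gT : finGroupType) (A : {group gT}) (b : gT).
Hypotheses (cAA : abelian A) (nAb : b \in 'N(A)).

Lemma commute_abelian x y : x \in A -> y \in A -> commute x y.
Proof. by move=> Ax Ay; apply: (centsP cAA). Qed.

Lemma prodgM_abelian n (F G : nat -> gT) :
    (forall i, F i \in A) -> (forall i, G i \in A) ->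
  \prod_(i < n) (F i * G i) = (\prod_(i < n) F i) * \prod_(i < n) G i.
Proof.
move=> AF AG; elim: n => [|n IHn]; first by rewrite !big_ord0 mulg1.
rewrite !big_ord_recr /= IHn !mulgA; congr (_ * _); rewrite -!mulgA.
by congr (_ * _); apply: commute_abelian => //; apply: group_prod.
Qed.

Lemma expg_prod_abelian n (F : nat -> gT) k :
  (forall i, F i \in A) -> (\prod_(i < n) F i) ^+ k = \prod_(i < n) F i ^+ k.
Proof.
move=> AF; elim: n => [|n IHn]; first by rewrite !big_ord0 expg1n.
rewrite !big_ord_recr /= expgMn ?IHn //.
by apply: commute_abelian => //; apply: group_prod.
Qed.

Lemma prodgV_abelian n (F : nat -> gT) :
  (forall i, F i \in A) -> \prod_(i < n) (F i)^-1 = (\prod_(i < n) F i)^-1.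
Proof.
move=> AF; elim: n => [|n IHn]; first by rewrite !big_ord0 invg1.
rewrite !big_ord_recr /= IHn invMg; apply: commute_abelian; rewrite groupV //.
exact: group_prod.
Qed.

(** In [U] with [b0], the sequence started at [a 0] runs through the generators [a i]; its term of
    index [p] is what the last defining relation prescribes. *)
Definition comm_seq (x : gT) (i : nat) := iter i (fun z => [~ z, b]) x.

Lemma comm_seqJ x i : comm_seq x i ^ b = comm_seq x i * comm_seq x i.+1.
Proof. exact: conjg_mulR. Qed.

Lemma mem_comm_seq x i : x \in A -> comm_seq x i \in A.
Proof.
by move=> Ax; elim: i => //= i IHi; rewrite commgEl groupM ?groupV ?memJ_norm.
Qed.

(** On the abelian group [A], conjugation by [b] is 1 + d, where d is the endomorphism z -> [z, b];
    this is the binomial expansion of (1 + d)^n, obtained from Pascal's rule. *)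
Lemma conjX_comm_seq x n :
  x \in A -> x ^ (b ^+ n) = \prod_(i < n.+1) comm_seq x i ^+ 'C(n, i).
Proof.
move=> Ax; have Ay i := mem_comm_seq i Ax.
elim: n => [|n IHn]; first by rewrite big_ord1 expg1 conjg1.
rewrite expgSr conjgM IHn.
have -> : (\prod_(i < n.+1) comm_seq x i ^+ 'C(n, i)) ^ b =
    \prod_(i < n.+1) (comm_seq x i ^+ 'C(n, i) * comm_seq x i.+1 ^+ 'C(n, i)).
  rewrite (big_morph (fun z => z ^ b) (fun y z => conjMg y z b) (conj1g b)).
  apply: eq_bigr => i _; rewrite conjXg comm_seqJ expgMn //.
  exact: commute_abelian.
rewrite (@prodgM_abelian _ (fun i => comm_seq x i ^+ 'C(n, i))
  (fun i => comm_seq x i.+1 ^+ 'C(n, i))); try by move=> i; rewrite groupX.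
rewrite [RHS]big_ord_recl /= bin0.
under [in RHS]eq_bigr => i _ do rewrite /bump leq0n add1n binS expgD.
rewrite (@prodgM_abelian _ (fun i => comm_seq x i.+1 ^+ 'C(n, i.+1))
  (fun i => comm_seq x i.+1 ^+ 'C(n, i))); try by move=> i; rewrite groupX.
rewrite mulgA; congr (_ * _).
(* One term too many is split off at the front; the extra last one vanishes because 'C(n, n.+1) =
   0. *)
have := @big_ord_recl _ 1 mulg n.+1 (fun i => comm_seq x i ^+ 'C(n, i)).
by rewrite big_ord_recr /= bin_small // expg0 mulg1 bin0.
Qed.

(** In additive terms, the sum of (1 + d)^i for i < n is ((1 + d)^n - 1) / d. *)
Lemma norm_comm_seq x n : x \in A ->
  \prod_(i < n) x ^ (b ^+ i) = \prod_(i < n) comm_seq x i ^+ 'C(n, i.+1).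
Proof.
move=> Ax; have Ay i := mem_comm_seq i Ax.
elim: n => [|n IHn]; first by rewrite !big_ord0.
under [RHS]eq_bigr => i _ do rewrite binS expgD.
rewrite big_ord_recr IHn /=.
rewrite (@prodgM_abelian _ (fun i => comm_seq x i ^+ 'C(n, i.+1))
  (fun i => comm_seq x i ^+ 'C(n, i))); try by move=> i; rewrite groupX.
by rewrite conjX_comm_seq // [in RHS]big_ord_recr /= bin_small // expg0 mulg1.
Qed.

Lemma expgM_norm w n :
  w \in A -> (b * w) ^+ n = b ^+ n * \prod_(i < n) w ^ (b ^+ i).
Proof.
move=> Aw; have Awb i : w ^ (b ^+ i) \in A by rewrite memJ_norm ?groupX.
elim: n => [|n IHn]; first by rewrite big_ord0 mulg1.
rewrite expgS IHn big_ord_recr /= [X in _ = _ * X]commute_abelian ?group_prod //.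
by rewrite expgS !mulgA -(mulgA b w) (conjgC w) !mulgA.
Qed.

(** In the expansion of the norm, the binomials strictly between the end terms are multiples of p,
    so the power [p ^ m] kills those terms and only the first and last survive. *)
Lemma norm_expg_comm_seq p m x : prime p -> x \in A ->
    (forall i, comm_seq x i.+1 ^+ (p ^ m.+1) = 1) ->
  (\prod_(i < p) x ^ (b ^+ i)) ^+ (p ^ m)
    = x ^+ (p ^ m.+1) * comm_seq x p.-1 ^+ (p ^ m).
Proof.
move=> p_pr Ax y1; have Ay i := mem_comm_seq i Ax.
rewrite norm_comm_seq //.
rewrite (@expg_prod_abelian _ (fun i => comm_seq x i ^+ 'C(p, i.+1))); last first.
  by move=> i; rewrite groupX.
case: p p_pr y1 => [|[|p]] // p_pr y1.
rewrite big_ord_recl big_ord_recr /= bin1 -expgM -expnS; congr (_ * _).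
rewrite big1 ?mul1g => [|i _]; first by rewrite /bump leq0n add1n binn expg1.
have /dvdnP[c ->] : p.+2 %| 'C(p.+2, i.+2).
  by rewrite prime_dvd_bin //= !ltnS.
by rewrite -expgM -mulnA -expnS mulnC expgM [_ ^+ (_ ^ _)](y1 i) expg1n.
Qed.

(** The right factor has the shape of the generator of [D]: this links the vanishing of powers
    outside [A] with [D]. *)
Lemma expg_comm_seq p m x : prime p -> x \in A -> b ^+ p \in 'C(A) ->
    (forall i, comm_seq x i.+1 ^+ (p ^ m.+1) = 1) ->
  (b * x) ^+ (p ^ m.+1)
    = b ^+ (p ^ m.+1) * (x ^+ (p ^ m.+1) * comm_seq x p.-1 ^+ (p ^ m)).
Proof.
move=> p_pr Ax cAbp y1; rewrite -norm_expg_comm_seq // expnS !expgM expgM_norm //.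
rewrite expgMn //; apply: (centP cAbp); apply: group_prod => i _.
by rewrite memJ_norm ?groupX.
Qed.

(** Cancelling the term of index 0 in the expansion of (1 + d)^p leaves exactly the relation that
    defines phi on the last generator. *)
Lemma conjX_comm_seq_last p x : 0 < p -> x \in A ->
  (x ^ (b ^+ p) == x) =
    (comm_seq x p == \prod_(1 <= j < p) (comm_seq x j ^+ 'C(p, j))^-1).
Proof.
case: p => // p _ Ax; have Ay i := mem_comm_seq i Ax.
rewrite big_add1 big_mkord.
rewrite (@prodgV_abelian _ (fun j => comm_seq x j.+1 ^+ 'C(p.+1, j.+1))).
  rewrite (conjX_comm_seq p.+1 Ax) big_ord_recl big_ord_recr /=.
  rewrite /bump leq0n add1n binn bin0 !expg1 -[X in _ == X]mulg1.
  by rewrite (inj_eq (mulgI x)) [RHS]eq_sym eq_mulVg1 invgK.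
by move=> i; rewrite groupX.
Qed.

Lemma comm_seq_expg1 x k i :
  x \in A -> [~ x, b] ^+ k = 1 -> comm_seq x i.+1 ^+ k = 1.
Proof.
move=> Ax xb1; elim: i => //= i IHi; have Ay := mem_comm_seq i.+1 Ax.
rewrite commgEl expgMn; last first.
  by apply: commute_abelian; rewrite ?groupV ?memJ_norm.
by rewrite expgVn -conjXg [_ ^+ k]IHi conj1g invg1 mulg1.
Qed.

(** Conjugating by [b] permutes the factors of the norm cyclically. *)
Lemma prod_conjXJ n x : b ^+ n \in 'C(A) -> x \in A ->
  \prod_(i < n) (x ^ b) ^ (b ^+ i) = \prod_(i < n) x ^ (b ^+ i).
Proof.
move=> cAbn Ax; have Axb i : x ^ (b ^+ i) \in A by rewrite memJ_norm ?groupX.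
(* The same product is split at its first factor on one side and at its last on the other; both of
   these factors equal [x]. *)
have: \prod_(i < n.+1) x ^ (b ^+ i) = \prod_(i < n.+1) x ^ (b ^+ i) by [].
rewrite {1}big_ord_recl big_ord_recr /= conjg1 (conjgE x) -(centP cAbn _ Ax) mulKg.
rewrite [RHS]commute_abelian ?group_prod // => /mulgI <-.
by apply: eq_bigr => i _; rewrite -conjgM -expgS.
Qed.

End CommSeq.

(** * Abelian groups given by generators, and morphisms built from their graphs *)

Lemma bigdprod_cycle_abelian (gT : finGroupType) n (a : nat -> gT)
    (W : {group gT}) :
  \big[dprod/1]_(i < n) <[a i]> = W -> abelian W.
Proof.
move/bigdprodWcp/(der_bigcprod 1) => defW'.
rewrite abelianE; apply/commG1P; rewrite -derg1 -defW' big1 // => i _.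
by apply/derG1P; apply: cycle_abelian.
Qed.

Lemma bigdprod_cycle_gen (gT : finGroupType) n (a : nat -> gT)
    (W : {group gT}) :
  \big[dprod/1]_(i < n) <[a i]> = W -> W :=: <<[set a (val i) | i : 'I_n]>>.
Proof.
move/bigdprodWY <-; apply/eqP; rewrite eqEsubset !gen_subG.
apply/andP; split.
  by apply/bigcupsP=> i _; rewrite cycle_subG mem_gen // imset_f.
apply/subsetP=> _ /imsetP[i _ ->]; apply: mem_gen.
by apply/bigcupP; exists i; rewrite ?cycle_id.
Qed.

Lemma card_gen_abelian (gT : finGroupType) n (z : nat -> gT) :
    abelian <<[set z (val i) | i : 'I_n]>> ->
  #|<<[set z (val i) | i : 'I_n]>>| <= \prod_(i < n) #[z i].
Proof.
elim: n => [|n IHn] cKK.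
  rewrite big_ord0 (_ : [set _ | _ : _] = set0) ?gen0 ?cards1 //.
  by apply/setP=> x; rewrite inE; apply/imsetP=> [[[]]].
have defS : [set z (val i) | i : 'I_n.+1] = [set z n] :|: [set z (val i) | i : 'I_n].
  apply/setP=> x; rewrite !inE.
  apply/imsetP/orP=> [[i _ ->] | [/eqP-> | /imsetP[i _ ->]]].
  - have [lt_in | ] := ltnP i n; first right.
      by apply/imsetP; exists (Ordinal lt_in).
    move=> le_ni; left; rewrite (_ : val i = n) //; apply/eqP.
    by rewrite eqn_leq le_ni -ltnS /= ltn_ord.
  - by exists ord_max.
  by exists (widen_ord (leqnSn n) i).
rewrite defS in cKK *.
have sSS := genS (subsetUr [set z n] [set z (val i) | i : 'I_n]).
rewrite -joingE -joing_idl -joing_idr cent_joinEl; last first.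
  exact: subset_trans (genS (subsetUl _ _)) (subset_trans cKK (centS sSS)).
rewrite big_ord_recr /= mulnC.
apply: leq_trans (_ : #[z n] * #|<<[set z (val i) | i : 'I_n]>>| <= _)%N.
  by rewrite /order mul_cardG leq_pmulr ?cardG_gt0.
by rewrite leq_mul2l IHn ?orbT // (abelianS sSS).
Qed.

(** By counting, the first projection is a bijection from [G] onto [U]; its inverse followed by the
    second projection is the morphism. *)
Lemma morphism_of_graph (gT rT : finGroupType) (U : {group gT})
    (G : {group gT * rT}) :
    U \subset fst_morphism gT rT @* G -> #|G| <= #|U| ->
  exists f : {morphism U >-> rT}, forall x y, (x, y) \in G -> f x = y.
Proof.
rewrite morphimE setTI => sUG leGU.
have oG : #|[set u.1 | u in G]| = #|G|.
  by apply/eqP; rewrite eqn_leq leq_imset_card (leq_trans leGU) ?subset_leq_card.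
have defU : [set u.1 | u in G] = U.
  by apply/esym/eqP; rewrite eqEcard sUG oG.
have inj1 : {in G &, injective fst}.
  by apply/imset_injP; rewrite oG.
have exg x : exists y : rT, (x \in U) ==> ((x, y) \in G).
  (* The value 1 outside [U] is a dummy that makes the choice function total. *)
  case Ux: (x \in U); last by exists 1.
  by move: Ux; rewrite -defU => /imsetP[[u v] Guv ->]; exists v.
pose g x := xchoose (exg x).
have Gg x : x \in U -> (x, g x) \in G.
  by move=> Ux; apply: (implyP (xchooseP (exg x))).
have gE x y : (x, y) \in G -> g x = y.
  move=> Gxy; have Ux : x \in U by rewrite -defU; apply/imsetP; exists (x, y).
  by case: (inj1 _ _ (Gg x Ux) Gxy erefl).
have gM : {in U &, {morph g : x y / x * y}}.
  move=> x y Ux Uy; apply: gE.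
  exact: (groupM (Gg x Ux) (Gg y Uy)).
by exists (Morphism gM).
Qed.

(* The subgroup of gT * rT generated by the (a_i, y_i) and (b0, b) projects onto
   U and has at most #|U| elements, so it is the graph of the morphism. *)
Lemma is_U_morphism p m (gT rT : finGroupType) (U W : {group gT})
    (a : nat -> gT) b0 (y : nat -> rT) b :
    0 < p -> is_U p m U W a b0 ->
    (forall i j, commute (y i) (y j)) ->
    (forall i, i < p -> y i ^+ #[a i] = 1) -> b ^+ #[b0] = 1 ->
    (forall i, i.+1 < p -> y i ^ b = y i * y i.+1) ->
    y p.-1 ^ b = y p.-1 * (\prod_(1 <= j < p) (y j ^+ 'C(p, j))^-1) ->
  exists f : {morphism U >-> rT}, (forall i, i < p -> f (a i) = y i) /\ f b0 = b.
Proof.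
case: p => // p _ [[defW _ _ _] [defU aJ aJp]] yC yX bX yJ yJp.
have cWW := bigdprod_cycle_abelian defW.
have genW := bigdprod_cycle_gen defW.
have Wa i : i < p.+1 -> a i \in W.
  by move=> lt_ip; rewrite genW mem_gen //; apply/imsetP; exists (Ordinal lt_ip).
pose z i : gT * rT := (a i, y i); pose c : gT * rT := (b0, b).
pose K := <<[set z (val i) | i : 'I_p.+1]>>.
have Kz i : i < p.+1 -> z i \in K.
  by move=> lt_ip; apply/mem_gen/imsetP; exists (Ordinal lt_ip).
have cKK : abelian K.
  rewrite abelian_gen; apply/centsP=> _ /imsetP[i _ ->] _ /imsetP[j _ ->].
  congr (_, _); last exact: yC.
  by apply: (centsP cWW); apply: Wa; apply: ltn_ord.
have pairX (u : gT * rT) n : u ^+ n = (u.1 ^+ n, u.2 ^+ n).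
  by elim: n => // n IHn; rewrite !expgS IHn.
have nKc : <[c]> \subset 'N(K).
  rewrite cycle_subG inE -genJ gen_subG.
  apply/subsetP=> _ /imsetP[_ /imsetP[i _ ->] ->].
  have [lt_ip | ] := ltnP i p.
    rewrite (_ : z i ^ c = z i * z i.+1) ?groupM ?Kz ?ltnS //; first exact: ltnW.
    by rewrite -[RHS]/(_, _) -aJ // -yJ.
  rewrite leq_eqVlt ltnNge -ltnS ltn_ord orbF /= => /eqP <-.
  rewrite -/K (_ : z p ^ c = z p * \prod_(1 <= j < p.+1) (z j ^+ 'C(p.+1, j))^-1).
    rewrite groupM ?Kz // big_add1 big_mkord group_prod // => j _.
    by rewrite groupV groupX ?Kz // ltnS.
  rewrite -[LHS]/(a p ^ b0, y p ^ b) aJp yJp; congr (_ * _, _ * _).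
    rewrite (big_morph (@fst gT rT) (id1 := 1) (op1 := mulg)) //.
    by apply: eq_bigr => j _; rewrite pairX.
  rewrite (big_morph (@snd gT rT) (id1 := 1) (op1 := mulg)) //.
  by apply: eq_bigr => j _; rewrite pairX.
(* The order conditions on [y] and [b] make the order of each pair divide that of its first
   component. *)
have leG : #|K <*> <[c]>| <= #|U|.
  rewrite norm_joinEr // -(sdprod_card defU) -(bigdprod_card defW).
  apply: leq_trans (_ : #|K| * #[c] <= _)%N.
    by rewrite mul_cardG leq_pmulr ?cardG_gt0.
  rewrite leq_mul //; last first.
    by rewrite dvdn_leq // order_dvdn pairX /= expg_order bX.
  apply: leq_trans (card_gen_abelian cKK) _; apply: leq_prod => i _.
  by rewrite dvdn_leq // order_dvdn pairX /= expg_order yX.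
case: (@morphism_of_graph _ _ U (K <*> <[c]>)%G _ leG) => [|f fE]; last first.
  exists f; split=> [i lt_ip|]; apply: fE.
    by rewrite (subsetP (joing_subl _ _)) // Kz.
  by rewrite (subsetP (joing_subr _ _)) // cycle_id.
rewrite -(sdprodWY defU) genW join_subG.
rewrite gen_subG cycle_subG; apply/andP; split.
  apply/subsetP=> _ /imsetP[i _ ->]; apply/morphimP; exists (z i); rewrite ?inE //.
  by rewrite (subsetP (joing_subl _ _)) // Kz.
apply/morphimP; exists c; rewrite ?inE //.
by rewrite (subsetP (joing_subr _ _)) // cycle_id.
Qed.

(** * Exponent-critical p-groups and those of type A *)

(** The lcm divides [p ^ m.+1], so it differs from it exactly when every exponent involved divides
    [p ^ m]. *)
Lemma exp_criticalP (gT : finGroupType) (G : {group gT}) p m :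
    prime p -> exponent G = (p ^ m.+1)%N ->
  reflect (forall H : {group gT},
             H \proper G -> ~~ abelian H -> exponent H %| p ^ m)
          (exp_critical G).
Proof.
move=> p_pr expG; rewrite /exp_critical /lcm_exp_nonab expG.
have lcmG : \big[lcmn/1%N]_(H : {group gT} | (H \proper G) && ~~ abelian H)
    exponent H %| p ^ m.+1.
  apply/dvdn_biglcmP=> H /andP[sHG _].
  by rewrite -expG exponentS ?proper_sub.
apply: (iffP idP) => [neq H ltHG nabH | critG].
  have dvH : exponent H %| p ^ m.+1 by rewrite -expG exponentS ?proper_sub.
  have /(dvdn_pfactor _ _ p_pr)[k le_km expH] := dvH.
  rewrite expH dvdn_exp2l // -ltnS ltn_neqAle le_km andbT.
  apply: contraNneq neq => km; rewrite eqn_dvd lcmG andbT -km -expH.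
  by apply: (@biglcmn_sup _ H); rewrite ?ltHG.
apply/negP=> /eqP defm; have: p ^ m.+1 %| p ^ m.
  rewrite {1}defm; apply/dvdn_biglcmP=> H /andP[]; exact: critG.
by rewrite dvdn_Pexp2l ?prime_gt1 // ltnn.
Qed.

Lemma pgroup_expX_Phi (gT : finGroupType) (P : {group gT}) (p : nat) g :
  p.-group P -> g \in P -> g ^+ p \in 'Phi(P).
Proof.
move=> pP Pg; rewrite (Phi_joing pP) (subsetP (joing_subr _ _)) //.
by rewrite -[p in g ^+ p]expn1 Mho_p_elt // (mem_p_elt pP).
Qed.

Lemma pgroup_Phi_der (gT : finGroupType) (P : {group gT}) (p : nat) :
  p.-group P -> P^`(1) \subset 'Phi(P).
Proof. by move=> pP; rewrite (Phi_joing pP) joing_subl. Qed.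

Lemma cycle_sub_maximal (gT : finGroupType) (P : {group gT}) g :
    ~~ abelian P -> g \in P ->
  exists2 M : {group gT}, maximal M P & g \in M.
Proof.
move=> nabP Pg; have sgP : <[g]> \subset P by rewrite cycle_subG.
have [defP | [M maxM sgM]] := maximal_exists sgP.
  by case/negP: nabP; rewrite -defP cycle_abelian.
by exists M; rewrite -?cycle_subG.
Qed.

Lemma typeA_structure (gT : finGroupType) (P : {group gT}) p m :
    prime p -> p.-group P -> ~~ abelian P -> exp_critical P ->
    exponent P = (p ^ m.+1)%N -> typeA P ->
  exists (A : {group gT}) (x b : gT),
  [/\ abelian A, maximal A P,
      forall M : {group gT}, maximal M P -> abelian M -> M :=: A,
      forall M : {group gT}, maximal M P -> M :!=: A -> exponent M %| p ^ m
    & forall g, g \in P -> g \notin A -> g ^+ (p ^ m) = 1] /\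
  [/\ x \in A, #[x] = (p ^ m.+1)%N, b \in P, b \notin A & <<[set x; b]>> = P].
Proof.
move=> p_pr pP nabP critP expP /cards1P[A defA].
have [maxA cAA] : maximal A P /\ abelian A.
  by apply/andP; have:= set11 A; rewrite -defA inE.
have uniqA (M : {group gT}) : maximal M P -> abelian M -> M :=: A.
  by move=> maxM cMM; congr gval; apply/set1P; rewrite -defA inE maxM.
have expM (M : {group gT}) : maximal M P -> M :!=: A -> exponent M %| p ^ m.
  move=> maxM neMA; apply: (exp_criticalP p_pr expP) => //.
    exact: maxgroupp maxM.
  by apply: contra neMA => cMM; rewrite (uniqA M).
have outA g : g \in P -> g \notin A -> g ^+ (p ^ m) = 1.
  move=> Pg nAg; have [M maxM Mg] := cycle_sub_maximal nabP Pg.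
  apply: (exponentP (expM M maxM _)) => //.
  by apply: contraNneq nAg => <-.
have [x Px ox] := exponent_witness (pgroup_nil pP).
have Ax : x \in A.
  apply: contraT => /(outA x Px)/eqP; rewrite -order_dvdn -ox expP.
  by rewrite dvdn_Pexp2l ?prime_gt1 // ltnn.
have /andP[sAP /subsetPn[b Pb nAb]] := maxgroupp maxA.
exists A, x, b; do 2![split] => //; first by rewrite -ox.
have sxbP : <<[set x; b]>> \subset P.
  by rewrite gen_subG subUset !sub1set Px.
(* A maximal subgroup containing both [x] and [b] would differ from [A], so its exponent would be
   too small for the order of [x]. *)
have [-> // | [M maxM sxbM]] := maximal_exists sxbP.
have Mx : x \in M by rewrite (subsetP sxbM) // mem_gen // set21.
have Mb : b \in M by rewrite (subsetP sxbM) // mem_gen // set22.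
have /(expM M maxM)/exponentP/(_ x Mx)/eqP : M :!=: A.
  by apply: contraNneq nAb => <-.
by rewrite -order_dvdn -ox expP dvdn_Pexp2l ?prime_gt1 // ltnn.
Qed.

(** Since [b] and [b * x] square to 1, [b] inverts [x], so the group has order at most 8. Its
    maximal subgroups then have order at most 4 and are abelian, including one that contains [b]. *)
Lemma no_typeA_exponent4 (gT : finGroupType) (P : {group gT}) :
    2.-group P -> ~~ abelian P -> exp_critical P ->
  exponent P = (2 ^ 2)%N -> ~~ typeA P.
Proof.
move=> pP nabP critP expP; apply/negP=> tA.
have [A [x [b [[cAA maxA uniqA _ outA] [Ax ox Pb nAb genP]]]]] :=
  typeA_structure (isT : prime 2) pP nabP critP expP tA.
have sAP := proper_sub (maxgroupp maxA); have Px := subsetP sAP x Ax.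
have b2 : b ^+ 2 = 1 by apply: outA.
have bx2 : (b * x) ^+ 2 = 1 by apply: outA; [apply: groupM | rewrite groupMr].
have nxb : <[b]> \subset 'N(<[x]>).
  rewrite cycle_subG inE -cycleJ cycle_subG.
  have -> : x ^ b = x^-1; last by rewrite groupV cycle_id.
  have bV : b^-1 = b by apply/eqP; rewrite eq_invg_mul -b2.
  by apply: (mulIg x); rewrite conjgE bV mulVg -bx2 expgS expg1 !mulgA.
have leP : #|P| <= 8.
  rewrite -genP -joingE -joing_idl -joing_idr norm_joinEr //.
  apply: leq_trans (_ : #[x] * #[b] <= _)%N.
    by rewrite mul_cardG leq_pmulr ?cardG_gt0.
  by rewrite ox (@leq_mul2l 4 _ 2) dvdn_leq ?orbT // order_dvdn b2.
have [M maxM Mb] := cycle_sub_maximal nabP Pb.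
have cMM : abelian M.
  apply: (@p2group_abelian _ 2).
    exact: pgroupS (proper_sub (maxgroupp maxM)) pP.
  have := Lagrange (proper_sub (maxgroupp maxM)).
  have [n oM] := p_natP (pgroupS (proper_sub (maxgroupp maxM)) pP).
  rewrite (p_maximal_index pP maxM) oM pfactorK // => oP.
  by move: leP; rewrite -oP -expnSr (leq_exp2l _ 3).
by case/negP: nAb; rewrite -(uniqA M).
Qed.

(** * The structure of U and the powers of its elements *)

Section UStructure.

Variables (p m : nat) (gT : finGroupType) (U W : {group gT}).
Variables (a : nat -> gT) (b0 : gT).
Hypotheses (p_pr : prime p) (isU : is_U p m.+2 U W a b0).

Let defW : \big[dprod/1]_(i < p) <[a i]> = W.
Proof. by case: isU => [[]]. Qed.

Let defU : W ><| <[b0]> = U.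
Proof. by case: isU => [_ []]. Qed.

Let cWW : abelian W.
Proof. exact: bigdprod_cycle_abelian defW. Qed.

Let nWb0 : b0 \in 'N(W).
Proof. by have [_ _ _] := sdprod_context defU; rewrite cycle_subG. Qed.

Let p1 : 1 < p.
Proof. exact: prime_gt1. Qed.

Let mulWb0 : <[b0]> * W = U.
Proof.
by rewrite -(sdprodW defU) normC ?cycle_subG.
Qed.

Let order_a0 : #[a 0] = (p ^ m.+2)%N.
Proof. by case: isU => [[]]. Qed.

Let order_aS i : 1 <= i < p -> #[a i] = (p ^ m.+1)%N.
Proof. by case: isU => [[_ _ oa _] _]; apply: oa. Qed.

Let order_b0 : #[b0] = (p ^ m.+1)%N.
Proof. by case: isU => [[]]. Qed.

Lemma U_mem_aW i : i < p -> a i \in W.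
Proof.
move=> lt_ip; rewrite (bigdprod_cycle_gen defW) mem_gen //.
by apply/imsetP; exists (Ordinal lt_ip).
Qed.

Let Wa0 : a 0 \in W.
Proof. by rewrite U_mem_aW ?prime_gt0. Qed.

Lemma U_subW : W \subset U.
Proof. by have [/andP[]] := sdprod_context defU. Qed.

Lemma U_mem_b0 : b0 \in U.
Proof. by have [_] := sdprod_context defU; rewrite cycle_subG. Qed.

Lemma U_comm_seq i : i < p -> comm_seq b0 (a 0) i = a i.
Proof.
case: isU => [_ [_ aJ _]].
elim: i => // i IHi lt_ip; rewrite /= IHi 1?ltnW //.
by rewrite commgEl aJ // mulKg.
Qed.

Lemma U_comm_seqS_expg i : comm_seq b0 (a 0) i.+1 ^+ (p ^ m.+1) = 1.
Proof.
apply: (comm_seq_expg1 cWW nWb0) => //.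
by rewrite [[~ _, _]](U_comm_seq p1) -(order_aS (i := 1)) ?expg_order ?p1.
Qed.

Lemma U_cent_b0p : b0 ^+ p \in 'C(W).
Proof.
have [_ [_ _ aJp]] := isU; have p0 := prime_gt0 p_pr.
have ca0 : b0 ^+ p \in 'C[a 0].
  apply/cent1P; apply/esym/commgP/conjg_fixP/eqP.
  rewrite (conjX_comm_seq_last cWW nWb0) //.
  rewrite -{1}(prednK p0) /= U_comm_seq ?prednK // commgEl aJp mulKg.
  apply/eqP; rewrite [LHS]big_nat [RHS]big_nat; apply: eq_bigr => j /andP[_ lt_jp].
  by rewrite U_comm_seq.
(* Both [a 0] and [b0] commute with [b0 ^+ p], hence so do all their iterated commutators. *)
have caS i : comm_seq b0 (a 0) i \in 'C[b0 ^+ p].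
  elim: i => [|i IHi]; first by rewrite cent1C.
  by rewrite groupR //; apply/cent1P; apply: commuteX.
rewrite -sub_cent1 (bigdprod_cycle_gen defW) gen_subG.
apply/subsetP=> _ /imsetP[i _ ->].
by rewrite -U_comm_seq; [apply: caS | apply: ltn_ord].
Qed.

Lemma U_pgroup : p.-group U.
Proof.
rewrite /pgroup -(sdprod_card defU) pnatM [#|<[b0]>|]order_b0 pnatX pnat_id // andbT.
rewrite -(bigdprod_card defW); elim/big_rec: _ => // -[[|i] lt_ip] n _ pn.
  by rewrite pnatM pn [#|_|]order_a0 pnatX pnat_id.
by rewrite pnatM pn [#|_|]order_aS // pnatX pnat_id.
Qed.

Lemma U_gen : <<[set a 0; b0]>> = U.
Proof.
apply/eqP; rewrite eqEsubset gen_subG subUset !sub1set U_mem_b0 (subsetP U_subW) //=.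
rewrite -(sdprodWY defU) join_subG cycle_subG mem_gen ?set22 // andbT.
rewrite (bigdprod_cycle_gen defW) gen_subG.
apply/subsetP=> _ /imsetP[[i lt_ip] _ ->] /=; rewrite -U_comm_seq //.
elim: {lt_ip} i => [|i IHi]; first by rewrite mem_gen ?set21.
by rewrite groupR // mem_gen ?set22.
Qed.

(** The power depends on [w] only through the morphism [f], a power of the norm. As [f] is invariant
    under [b0], it kills every commutator [a i.+1], and it sends [a 0] to the generator of [D]. *)
Lemma U_b0M_expg w : w \in W -> (b0 * w) ^+ (p ^ m.+1) \in D_of p m.+2 a.
Proof.
move=> Ww; have cb0p := U_cent_b0p.
have Wnorm v : v \in W -> \prod_(i < p) v ^ (b0 ^+ i) \in W.
  by move=> Wv; apply: group_prod => i _; rewrite memJ_norm ?groupX.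
pose f v := (\prod_(i < p) v ^ (b0 ^+ i)) ^+ (p ^ m).
have fM : {in W &, {morph f : u v / u * v}}.
  move=> u v Wu Wv; rewrite /f -expgMn; last first.
    by apply: (commute_abelian cWW); apply: Wnorm.
  rewrite -(@prodgM_abelian _ W cWW _ (fun i => u ^ (b0 ^+ i))
    (fun i => v ^ (b0 ^+ i))); try by move=> i; rewrite memJ_norm ?groupX.
  by congr (_ ^+ _); apply: eq_bigr => i _; rewrite conjMg.
have fJ v : v \in W -> f (v ^ b0) = f v.
  by move=> Wv; rewrite /f (prod_conjXJ cWW).
pose F := Morphism fM.
suffices: W \subset F @*^-1 D_of p m.+2 a.
  move/subsetP/(_ w Ww)/morphpreP=> [_ /=].
  rewrite /f expnS expgM (expgM_norm cWW) // expgMn; last first.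
    by apply: (centP cb0p); apply: Wnorm.
  by rewrite -expgM -expnS -order_b0 expg_order mul1g.
rewrite {1}(bigdprod_cycle_gen defW) gen_subG.
apply/subsetP=> _ /imsetP[[i lt_ip] _ ->] /=.
apply/morphpreP; split; first exact: U_mem_aW.
case: i lt_ip => [|i] lt_ip.
  rewrite /= /f (norm_expg_comm_seq cWW) //; last exact: U_comm_seqS_expg.
  by rewrite U_comm_seq ?cycle_id // prednK // prime_gt0.
rewrite -(U_comm_seq lt_ip) /= U_comm_seq ?(ltnW lt_ip) // commgEl.
rewrite fM ?groupV ?memJ_norm ?U_mem_aW ?(ltnW lt_ip) //.
rewrite fJ ?U_mem_aW ?(ltnW lt_ip) //.
rewrite -fM ?groupV ?U_mem_aW ?(ltnW lt_ip) // mulVg.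
by rewrite /f big1 ?expg1n // => j _; rewrite conj1g.
Qed.

(** Its image will be the abelian maximal subgroup of each quotient [U / N]. *)
Let A0 := (W <*> <[b0 ^+ p]>)%G.

Lemma U_A0_abelian : abelian A0.
Proof.
by rewrite abelianY cWW cycle_abelian cycle_subG U_cent_b0p.
Qed.

Lemma U_b0_notin_A0 : b0 \notin A0.
Proof.
apply/negP=> Ab0.
have : commute (a 0) b0.
  apply: (centsP U_A0_abelian) => //.
  by rewrite (subsetP (joing_subl _ _)).
move/commgP/eqP => a1; have := order_aS (i := 1).
rewrite -(U_comm_seq p1) /= a1 order1 => /(_ p1)/esym/eqP.
by rewrite expnS muln_eq1 (gtn_eqF p1).
Qed.

Lemma U_A0_sub : A0 \subset U.
Proof. by rewrite join_subG U_subW cycle_subG groupX ?U_mem_b0. Qed.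

Lemma U_A0_maximal : maximal A0 U.
Proof.
have p0 := prime_gt0 p_pr.
have [_ _ _ nWb tiWb] := sdprod_context defU.
have sbb : <[b0 ^+ p]> \subset <[b0]> := cycleX b0 p.
suffices idx : #|U : A0| = p by rewrite (p_index_maximal U_A0_sub) ?idx.
have oA0 : #|A0| = (#|W| * p ^ m)%N.
  rewrite /= norm_joinEr ?(subset_trans sbb) // TI_cardMg; last first.
    by apply/trivgP; rewrite -tiWb setIS.
  by congr (_ * _)%N; rewrite [LHS]orderXdiv order_b0 expnS ?dvdn_mulr // mulKn.
apply/eqP; rewrite -(eqn_pmul2l (cardG_gt0 A0)) Lagrange ?U_A0_sub // oA0.
by rewrite -(sdprod_card defU) [#|<[b0]>|]order_b0 -mulnA -expnSr.
Qed.

(* Passing to a power coprime to p reduces statements about elements outside A0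
   to the coset b0 W, where expgM_norm and the relations of U apply directly. *)
Lemma U_outside_A0 g : g \in U -> g \notin A0 ->
  exists l w, [/\ coprime p l, w \in W & g ^+ l = b0 * w].
Proof.
rewrite -{1}mulWb0 => /mulsgP[_ w /cycleP[k ->] Ww ->] nAg.
have cpk : coprime p k.
  rewrite prime_coprime //; apply: contra nAg => /dvdnP[j ->].
  rewrite mulnC expgM groupM ?(subsetP (joing_subl _ _) _ Ww) //.
  by rewrite groupX // (subsetP (joing_subr _ _)) ?cycle_id.
pose l := expg_invn <[b0]> k.
have b0K : b0 ^+ k ^+ l = b0.
  by apply: expgK; rewrite ?cycle_id // [#|_|]order_b0 coprimeXl.
have nWb0k : b0 ^+ k \in 'N(W) by rewrite groupX.
pose w' := \prod_(i < l) w ^ (b0 ^+ k ^+ i).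
have Ww' : w' \in W by apply: group_prod => i _; rewrite memJ_norm ?groupX.
have gl : (b0 ^+ k * w) ^+ l = b0 * w' by rewrite (expgM_norm cWW) // b0K.
exists l, w'; split=> //; rewrite prime_coprime //.
(* If p divided [l], then [g ^+ l] would be a power of [g ^+ p], hence in the Frattini subgroup and
   so in [A0], which would force [b0] into [A0]. *)
apply: contra U_b0_notin_A0 => /dvdnP[j lj].
have Ug : b0 ^+ k * w \in U.
  by apply: groupM; [apply/groupX/U_mem_b0 | apply: (subsetP U_subW)].
have /(groupX j) :=
  subsetP (Phi_sub_max U_A0_maximal) _ (pgroup_expX_Phi U_pgroup Ug).
rewrite -expgM mulnC -lj gl groupMr //.
by rewrite (subsetP (joing_subl _ _)).
Qed.

Lemma U_outside_A0_expg g :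
  g \in U -> g \notin A0 -> g ^+ (p ^ m.+1) \in D_of p m.+2 a.
Proof.
move=> Ug nAg; have [l [w [cpl Ww gl]]] := U_outside_A0 Ug nAg.
have col : coprime #|U| l.
  have [n ->] := p_natP U_pgroup.
  by apply: coprimeXl.
(* Since [l] is prime to the order of [U], [g] is itself a power of [g ^+ l]. *)
have -> : g ^+ (p ^ m.+1) = g ^+ l ^+ (p ^ m.+1) ^+ expg_invn U l.
  by rewrite [RHS]expgAC [in RHS](expgK col Ug).
rewrite gl.
by rewrite groupX // U_b0M_expg.
Qed.

Lemma U_aS_Phi i : i.+1 < p -> a i.+1 \in 'Phi(U).
Proof.
move=> lt_ip; rewrite (subsetP (pgroup_Phi_der U_pgroup)) //.
rewrite -U_comm_seq //= U_comm_seq ?(ltnW lt_ip) // mem_commg ?U_mem_b0 //.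
by rewrite (subsetP U_subW) // U_mem_aW // ltnW.
Qed.

Lemma U_maximal_expg (M : {group gT}) g :
  maximal M U -> M :!=: A0 -> g \in M -> g ^+ (p ^ m.+1) \in D_of p m.+2 a.
Proof.
move=> maxM neMA Mg.
have sMU := proper_sub (maxgroupp maxM); have Ug := subsetP sMU g Mg.
have [Ag | ] := boolP (g \in A0); last exact: U_outside_A0_expg.
(* With [a 0] added, [X] generates [A0]; but [X] lies in the Frattini subgroup, hence in [M], and
   its elements have order dividing [p ^ m.+1]. *)
pose X := [set a 0 ^+ p; b0 ^+ p] :|: [set a (val i) | i : 'I_p & 0 < i].
have sXPhi : X \subset 'Phi(U).
  have Ua0 : a 0 \in U := subsetP U_subW _ Wa0.
  rewrite !subUset !sub1set !(pgroup_expX_Phi U_pgroup) ?U_mem_b0 //=.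
  apply/subsetP=> x /imsetP[[[|i] lt_ip]]; rewrite inE //= => _ ->.
  exact: U_aS_Phi.
have sXA : X \subset A0 := subset_trans sXPhi (Phi_sub_max U_A0_maximal).
have sXM : X \subset M := subset_trans sXPhi (Phi_sub_max maxM).
have cXX : abelian X := abelianS sXA U_A0_abelian.
have expX : exponent <<X>> %| p ^ m.+1.
  rewrite abelian_exponent_gen //; apply/exponentP=> x.
  rewrite !inE -orbA => /or3P[/eqP-> | /eqP-> | /imsetP[[i lt_ip]]].
  - by rewrite -expgM -expnS -order_a0 expg_order.
  - by rewrite -expgM mulnC expgM -order_b0 expg_order expg1n.
  by rewrite inE /= => i_gt0 ->; rewrite -(@order_aS i) ?i_gt0 ?expg_order.
have sAX : A0 \subset <[a 0]> <*> <<X>>.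
  rewrite join_subG (bigdprod_cycle_gen defW) gen_subG cycle_subG; apply/andP; split.
    apply/subsetP=> _ /imsetP[[i lt_ip] _ ->] /=.
    case: i lt_ip => [|i] lt_ip; first by rewrite mem_gen // inE cycle_id.
    rewrite (subsetP (joing_subr _ _)) // mem_gen // !inE; apply/orP; right.
    by apply/imsetP; exists (Ordinal lt_ip); rewrite ?inE.
  by rewrite (subsetP (joing_subr _ _)) // mem_gen // !inE eqxx orbT.
have cent0X : <<X>> \subset 'C(<[a 0]>).
  rewrite gen_subG (subset_trans sXA) // (subset_trans U_A0_abelian) // centS //.
  by rewrite cycle_subG (subsetP (joing_subl _ _)).
have := subsetP sAX g Ag; rewrite cent_joinEr // => /mulsgP[_ s /cycleP[k ->] Xs gE].
(* If p divides [k], then [g] lies in the group generated by [X]; otherwise [a 0] lies in [M], which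
   would force [M] to be [A0]. *)
have [/dvdnP[j kj] | npk] := boolP (p %| k).
  suffices Xg : g \in <<X>> by rewrite (exponentP expX g Xg) group1.
  have Xap : a 0 ^+ p \in <<X>> by rewrite mem_gen // !inE eqxx.
  by rewrite gE kj mulnC expgM groupM // groupX.
case/negP: neMA; have Ma0 : a 0 \in M.
  have Ms : s \in M by rewrite (subsetP (_ : <<X>> \subset M)) // gen_subG.
  rewrite gE groupMr // in Mg.
  have <- : a 0 ^+ k ^+ expg_invn <[a 0]> k = a 0; last exact: groupX.
  apply: expgK; rewrite ?cycle_id // [#|_|]order_a0 coprimeXl //.
  by rewrite prime_coprime.
have sAM : A0 \subset M.
  by rewrite (subset_trans sAX) // join_subG cycle_subG Ma0 gen_subG.
have [_ /(_ M (maxgroupp maxM) sAM) ->] := maxgroupP U_A0_maximal.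
exact: eqxx.
Qed.

End UStructure.

(** * Groups of type A as quotients of U *)

(** The Frattini quotient of [U] has order at most p^2. If [N] were not inside the Frattini
    subgroup, that of [U / N] would have order at most p, so [U / N] would be cyclic. *)
Lemma rank2_ker_sub_Phi (gT : finGroupType) (U N : {group gT}) (p : nat) x y :
    prime p -> p.-group U -> <<[set x; y]>> = U -> N <| U ->
    ~~ abelian (U / N) ->
  N \subset 'Phi(U).
Proof.
move=> p_pr pU genU /andP[sNU nNU]; apply: contraR => nsNPhi.
have [sPhiU nPhiU] := andP (Phi_normal U).
have abelPhi := Phi_quotient_abelem pU.
have [Ux Uy] : x \in U /\ y \in U.
  by rewrite -genU !mem_gen ?set21 ?set22.
have leUPhi : #|U : 'Phi(U)| <= p ^ 2.
  rewrite -card_quotient //.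
  have defUb : U / 'Phi(U) = <[coset 'Phi(U) x]> <*> <[coset 'Phi(U) y]>.
    rewrite (congr1 (fun X : {set gT} => X / 'Phi(U)) (esym genU)).
    rewrite -joingE -joing_idl -joing_idr.
    by rewrite quotientY ?cycle_subG ?(subsetP nPhiU) //
      !quotient_cycle ?(subsetP nPhiU).
  have le_p z : z \in U -> #[coset 'Phi(U) z] <= p.
    move=> Uz; rewrite dvdn_leq ?prime_gt0 //.
    have := abelPhi; rewrite abelemE // => /andP[_].
    by apply: dvdn_trans; rewrite dvdn_exponent // mem_quotient.
  rewrite defUb cent_joinEr; last first.
    apply: sub_abelian_cent2 (abelem_abelian abelPhi) _ _;
      by rewrite cycle_subG mem_quotient.
  rewrite (leq_trans _ (leq_mul (le_p x Ux) (le_p y Uy))) //.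
  by rewrite mul_cardG leq_pmulr ?cardG_gt0.
have leK : #|U : N <*> 'Phi(U)| <= p.
  have sPhiK : 'Phi(U) \subset N <*> 'Phi(U) := joing_subr _ _.
  have sKU : N <*> 'Phi(U) \subset U by rewrite join_subG sNU.
  rewrite -(leq_pmul2r (prime_gt0 p_pr)) -[(p * p)%N]/(p ^ 2)%N.
  apply: leq_trans leUPhi; rewrite -(Lagrange_index sKU sPhiK) leq_mul2l.
  apply/orP; right.
  have pidx : p.-nat #|N <*> 'Phi(U) : 'Phi(U)|.
    by apply: pnat_dvd (dvdn_indexg _ _) (pgroupS sKU pU).
  have [n idx] := p_natP pidx.
  case: n idx => [|n] idx; last by rewrite idx expnS leq_pmulr ?expn_gt0 ?prime_gt0.
  case/negP: nsNPhi; apply: subset_trans (joing_subl N 'Phi(U)) _.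
  by rewrite -indexg_eq1 idx.
suffices: cyclic (U / N) by apply: cyclic_abelian.
apply: Phi_quotient_cyclic; rewrite -(quotient_Phi pU nNU).
have pQ : p.-group (U / N / ('Phi(U) / N)) by rewrite !quotient_pgroup.
have leQ : #|U / N / ('Phi(U) / N)| <= p.
  rewrite card_quotient ?quotient_norms //= -(quotientYidl (subset_trans sPhiU nNU)).
  rewrite index_quotient_eq ?join_subG ?sNU //.
  exact: subset_trans (subsetIr _ _) (joing_subl _ _).
have [[|[|n]] oQ] := p_natP pQ.
- by rewrite (card1_trivg oQ) cyclic1.
- by rewrite prime_cyclic // oQ.
by move: leQ; rewrite oQ -[X in _ <= X]expn1 leq_exp2l ?prime_gt1.
Qed.

Lemma typeA_quotient_U p m (gT hT : finGroupType) (U W : {group gT})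
    (a : nat -> gT) b0 (P : {group hT}) :
    prime p -> is_U p m.+2 U W a b0 ->
    p.-group P -> ~~ abelian P -> exp_critical P ->
    exponent P = (p ^ m.+2)%N -> typeA P ->
  exists2 N : {group gT}, in_calN p m.+2 U a N & P \isog U / N.
Proof.
move=> p_pr isU pP nabP critP expP tA.
have [A [x [b [[cAA maxA _ expM outA] [Ax ox Pb nAb genP]]]]] :=
  typeA_structure p_pr pP nabP critP expP tA.
have sAP := proper_sub (maxgroupp maxA); have Px := subsetP sAP x Ax.
have nAb' : b \in 'N(A).
  by have /andP[_ /subsetP->] := p_maximal_normal pP maxA.
have bp : b ^+ (p ^ m.+1) = 1 by apply: outA.
have bxp : (b * x) ^+ (p ^ m.+1) = 1.
  by apply: outA; [apply: groupM | rewrite groupMr].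
have Abp : b ^+ p \in A.
  by rewrite (subsetP (Phi_sub_max maxA)) // pgroup_expX_Phi.
have cAbp : b ^+ p \in 'C(A) by apply: subsetP Abp.
have y1 i : comm_seq b x i.+1 ^+ (p ^ m.+1) = 1.
  apply: (comm_seq_expg1 cAA nAb') => //.
  have [M maxM Mb] := cycle_sub_maximal nabP Pb.
  have neMA : M :!=: A by apply: contraNneq nAb => <-.
  apply: (exponentP (expM M maxM neMA)); apply: (subsetP (Phi_sub_max maxM)).
  by apply: (subsetP (pgroup_Phi_der pP)); apply: mem_commg.
have yA i := mem_comm_seq nAb' i Ax.
have p_gt0 := prime_gt0 p_pr; have p_gt1 := prime_gt1 p_pr.
have [[_ oa0 oa ob0] _] := isU.
have [f [fa fb]] : exists f : {morphism U >-> hT},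
    (forall i, i < p -> f (a i) = comm_seq b x i) /\ f b0 = b.
  apply: (is_U_morphism p_gt0 isU) => [i j|i lt_ip||i lt_ip|].
  - by apply: (centsP cAA).
  - case: i lt_ip => [|i] lt_ip; first by rewrite oa0 -ox expg_order.
    by rewrite oa ?y1.
  - by rewrite ob0.
  - exact: comm_seqJ.
  (* The last relation holds because [b ^+ p] centralises [x]. *)
  rewrite comm_seqJ prednK //; congr (_ * _); apply/eqP.
  rewrite -(conjX_comm_seq_last cAA nAb') //.
  by apply/eqP/conjg_fixP/commgP/esym; apply: (centP cAbp).
have Ub0 := U_mem_b0 isU.
have Ua i : i < p -> a i \in U.
  by move=> lt_ip; rewrite (subsetP (U_subW isU)) // (U_mem_aW isU).
have fU : f @* U = P.
  have genU := U_gen p_pr isU.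
  rewrite -(congr1 (fun X : {set gT} => f @* X) genU).
  rewrite morphim_gen ?subUset ?sub1set ?Ua ?Ub0 //.
  by rewrite morphimU !morphim_set1 ?Ua // fa // fb.
have isoP : P \isog U / 'ker f by rewrite isog_sym -fU first_isog.
exists ('ker f)%G => //; apply/and5P; split.
- exact: ker_normal.
- rewrite cycle_subG; apply/kerP; first by rewrite groupM ?groupX ?Ua ?prednK.
  rewrite morphM ?morphX ?groupX ?Ua ?prednK // !fa ?prednK //.
  (* The generator of [D] is sent to the power of [b * x], which is trivial because [b * x] lies
     outside [A]. *)
  by rewrite -[RHS]bxp (expg_comm_seq cAA nAb') // bp mul1g.
- apply: rank2_ker_sub_Phi p_pr (U_pgroup p_pr isU) (U_gen p_pr isU) _ _.
    exact: ker_normal.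
  by rewrite -(isog_abelian isoP).
(* The morphism is injective on the cycle of [a 0], whose image [x] has the same order. *)
- apply/eqP/trivgP/subsetP=> z /setIP[/mker fz /cycleP[k zE]].
  apply/set1P/eqP; rewrite zE -order_dvdn oa0 -ox order_dvdn.
  by rewrite -[x]/(comm_seq b x 0) -fa // -morphX ?Ua // -zE fz.
apply: contra nabP => sU'N; rewrite (isog_abelian isoP).
exact: sub_der1_abelian.
Qed.

(** * Exponent, criticality and abelian maximal subgroups of the quotients U / N *)

Section QuotientsOfU.

Variables (p m : nat) (gT : finGroupType) (U W N : {group gT}).
Variables (a : nat -> gT) (b0 : gT).
Hypotheses (p_pr : prime p) (isU : is_U p m.+2 U W a b0).
Hypothesis (calN : in_calN p m.+2 U a N).

Let A0 := (W <*> <[b0 ^+ p]>)%G.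

Let nsNU : N <| U.
Proof. by case/and5P: calN. Qed.

Let nNU : U \subset 'N(N).
Proof. exact: normal_norm. Qed.

Let sDN : D_of p m.+2 a \subset N.
Proof. by case/and5P: calN. Qed.

Let order_a0 : #[a 0] = (p ^ m.+2)%N.
Proof. by case: isU => [[]]. Qed.

Lemma calN_a0_expg : a 0 ^+ (p ^ m.+1) \notin N.
Proof.
have /and5P[_ _ _ /eqP tiNa _] := calN.
apply/negP=> Na; have : a 0 ^+ (p ^ m.+1) \in N :&: <[a 0]>.
  by rewrite inE Na mem_cycle.
rewrite tiNa => /set1P/eqP; rewrite -order_dvdn order_a0.
by rewrite dvdn_Pexp2l ?prime_gt1 // ltnn.
Qed.

Lemma quotient_U_nonabelian : ~~ abelian (U / N).
Proof.
have /and5P[_ _ _ _] := calN; apply: contra => cQQ; exact: der1_min.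
Qed.

Lemma quotient_U_pgroup : p.-group (U / N).
Proof. exact: quotient_pgroup (U_pgroup p_pr isU). Qed.

Lemma U_A0_exponent : exponent A0 %| p ^ m.+2.
Proof.
have [[defW _ oa ob0] _] := isU.
pose X := b0 ^+ p |: [set a (val i) | i : 'I_p].
have genX : A0 :=: <<X>>.
  by rewrite /= (bigdprod_cycle_gen defW) joingC joing_idl joing_idr joingE.
have cXX : abelian X by rewrite -abelian_gen -genX (U_A0_abelian p_pr isU).
rewrite genX abelian_exponent_gen //; apply/exponentP=> x.
rewrite !inE => /orP[/eqP-> | /imsetP[[i lt_ip] _ ->] /=].
  by rewrite -expgM mulnC expgM [(p ^ m.+2)%N]expnSr expgM -ob0 expg_order !expg1n.
case: i lt_ip => [|i] lt_ip; first by rewrite -order_a0 expg_order.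
by rewrite expnSr expgM -(oa i.+1) ?expg_order ?expg1n.
Qed.

Lemma exponent_quotient_U : exponent (U / N) = (p ^ m.+2)%N.
Proof.
have expQ : exponent (U / N) %| p ^ m.+2.
  apply/exponentP=> _ /morphimP[g Ng Ug ->].
  rewrite -morphX //; apply: coset_id.
  have [Ag | nAg] := boolP (g \in A0).
    by rewrite (exponentP U_A0_exponent g Ag) group1.
  rewrite expnSr expgM groupX // (subsetP sDN) //.
  exact: (U_outside_A0_expg p_pr isU).
have /(dvdn_pfactor _ _ p_pr)[k le_k expE] := expQ.
rewrite expE; congr (_ ^ _)%N; apply/eqP; rewrite eqn_leq le_k leqNgt.
(* A smaller exponent would put the power of [a 0] of order p inside [N]. *)
apply: contra calN_a0_expg => lt_k.
have Ua0 : a 0 \in U 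
  by rewrite (subsetP (U_subW isU)) // (U_mem_aW isU) // prime_gt0.
have Na0 : a 0 \in 'N(N) := subsetP nNU _ Ua0.
apply: coset_idr; rewrite ?groupX // morphX //.
have expQ1 : exponent (U / N) %| p ^ m.+1 by rewrite expE dvdn_exp2l.
exact: (exponentP expQ1) (mem_quotient N Ua0).
Qed.

Lemma quotient_U_maximal_expg (M : {group coset_of N}) :
  maximal M (U / N) -> M :!=: A0 / N -> exponent M %| p ^ m.+1.
Proof.
move=> maxM neMA; pose M1 := (coset N @*^-1 M)%G.
have maxM1 : maximal M1 U by rewrite -(quotientGK nsNU) cosetpre_maximal.
have neM1 : M1 :!=: A0.
  apply: contraNneq neMA => /= <-; by rewrite cosetpreK.
apply/exponentP=> z Mz; have [g Ng zE] := cosetP z.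
rewrite zE -morphX //; apply: coset_id; apply: (subsetP sDN).
apply: (U_maximal_expg p_pr isU maxM1 neM1).
by apply/morphpreP; split; rewrite //= -zE.
Qed.

Lemma quotient_A0_maximal : maximal (A0 / N) (U / N).
Proof.
have /and5P[_ _ sNPhi _ _] := calN.
have maxA := U_A0_maximal p_pr isU.
have sNA : N \subset A0 := subset_trans sNPhi (Phi_sub_max maxA).
rewrite quotient_maximal // /normal sNA (subset_trans _ nNU) //.
exact: proper_sub (maxgroupp maxA).
Qed.

Lemma quotient_A0_abelian : abelian (A0 / N).
Proof. exact: quotient_abelian (U_A0_abelian p_pr isU). Qed.

(** A proper non-abelian subgroup lies in a maximal subgroup, which cannot be the abelian [A0 / N]
    and so has small exponent. *)
Lemma quotient_U_critical : exp_critical (U / N).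
Proof.
apply/(exp_criticalP p_pr exponent_quotient_U) => H ltHU nabH.
have [HU | [M maxM sHM]] := maximal_exists (proper_sub ltHU).
  by rewrite HU properxx in ltHU.
apply: dvdn_trans (exponentS sHM) (quotient_U_maximal_expg maxM _).
apply: contraNneq nabH => defM; apply: abelianS sHM _.
by rewrite defM quotient_A0_abelian.
Qed.

Lemma quotient_U_typeA : odd p || (2 < m.+2) -> typeA (U / N).
Proof.
move=> p_odd_or_m; apply/cards1P; exists (A0 / N)%G.
apply/setP=> M; rewrite !inE; apply/andP/eqP=> [[maxM cMM] | ->]; last first.
  by rewrite quotient_A0_maximal quotient_A0_abelian.
apply/eqP/contraT=> neM; pose M1 := (coset N @*^-1 M)%G.
have maxM1 : maximal M1 U by rewrite -(quotientGK nsNU) cosetpre_maximal.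
have maxA := U_A0_maximal p_pr isU.
have [g Mg nAg] : exists2 g, g \in M1 & g \notin A0.
  apply/subsetPn; apply: contra neM => sMA; apply/eqP/val_inj => /=.
  have [_ /(_ A0 (maxgroupp maxA) sMA) defA] := maxgroupP maxM1.
  by rewrite -[A0 / N](congr1 (fun X : {set gT} => X / N) (esym defA)) cosetpreK.
have Ug := subsetP (proper_sub (maxgroupp maxM1)) g Mg.
have [l [w [_ Ww gl]]] := U_outside_A0 p_pr isU Ug nAg.
have Mbw : b0 * w \in M1 by rewrite -gl groupX.
have [[defW _ _ _] [_ aJ aJp]] := isU.
have cWW := bigdprod_cycle_abelian defW.
have Mcomm : M1^`(1) \subset N.
  rewrite der1_min ?cosetpreK //; apply: subset_trans nNU.
  exact: proper_sub (maxgroupp maxM1).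
(* Both [a i] and [b0 * w] lie in [M1], whose derived subgroup is in [N]; the factor [w] commutes
   with [W] and drops out of the commutator. *)
have aN i : 0 < i < p -> (a i)^-1 * a i ^ b0 \in N.
  case: i => // i /= lt_ip; have lt_ip' := ltnW lt_ip.
  have Ma : a i.+1 \in M1.
    by rewrite (subsetP (Phi_sub_max maxM1)) // (U_aS_Phi p_pr isU).
  have -> : (a i.+1)^-1 * a i.+1 ^ b0 = [~ a i.+1, b0 * w].
    rewrite commgEl conjgM; congr (_ * _); apply/esym/conjg_fixP/commgP.
    apply: (centsP cWW) => //; rewrite memJ_norm ?(U_mem_aW isU) //.
    have [_ [/sdprod_context[_ _ _ nWb _] _ _]] := isU.
    by rewrite (subsetP nWb) // cycle_id.
  by rewrite (subsetP Mcomm) // mem_commg.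
(* For p = 2 the commutator of [a 1] with [b0] is the inverse square of [a 1], and [0 < m] makes the
   exponent even. For odd p, [a p.-1] is itself the commutator of [a p.-2] with [b0], and the index
   [p.-2] is positive. *)
have aN1 : a p.-1 ^+ (p ^ m) \in N.
  case: (even_prime p_pr) p_odd_or_m => [p2 | p_odd _].
    rewrite p2 /= !ltnS => m_gt0.
    move: (aN 1%N); rewrite p2 /= in aJp *; move/(_ isT); rewrite aJp mulKg.
    rewrite big_nat1 groupV -(prednK m_gt0) expnS expgM => Na.
    exact: groupX.
  have p_gt2 := odd_prime_gt2 p_odd p_pr.
  have := aN p.-2; rewrite aJ; last by case: (p) p_gt2 => [|[|[|]]].
  case: (p) p_gt2 => [|[|[|q]]] //= _ aNq.
  by rewrite groupX // -[a _](mulKg (a q.+1)) aNq //= ltnW.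
(* Multiplying by this element turns the power of [a 0] into the generator of [D], which lies in
   [N]. *)
case/negP: calN_a0_expg; rewrite -(groupMr _ aN1).
by rewrite (subsetP sDN) // cycle_id.
Qed.

End QuotientsOfU.

Theorem theoremE (p m : nat) (gT : finGroupType) (U W : {group gT})
    (a : nat -> gT) (b0 : gT) :
  prime p -> 2 <= m -> is_U p m U W a b0 ->
  [/\ (* (i) *)
      (forall (hT : finGroupType) (P : {group hT}),
         p.-group P -> ~~ abelian P -> exp_critical P ->
         exponent P = (p ^ m)%N -> typeA P ->
         exists2 N : {group gT}, in_calN p m U a N & P \isog U / N),
      (* (ii) *)
      (forall N : {group gT}, in_calN p m U a N ->
         [/\ p.-group (U / N), ~~ abelian (U / N), exp_critical (U / N)
           & exponent (U / N) = (p ^ m)%N]),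
      (* (iii), first sentence *)
      (forall (hT : finGroupType) (P : {group hT}),
         2.-group P -> ~~ abelian P -> exp_critical P ->
         exponent P = (2 ^ 2)%N -> ~~ typeA P) &
      (* (iii), second sentence *)
      (odd p || (3 <= m) -> forall N : {group gT}, in_calN p m U a N ->
         [/\ p.-group (U / N), exp_critical (U / N),
             exponent (U / N) = (p ^ m)%N & typeA (U / N)])].
Proof.
(* The earlier results are stated for [m.+2], so that the exponents m - 1 and m - 2 become [m.+1]
   and [m]. *)
case: m => [|[|m]] // p_pr _ isU; split.
- by move=> hT P; apply: typeA_quotient_U p_pr isU.
- move=> N calN; split.
  + exact: quotient_U_pgroup p_pr isU.
  + exact: quotient_U_nonabelian calN.
  + exact: quotient_U_critical p_pr isU calN.
  exact: exponent_quotient_U p_pr isU calN.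
- by move=> hT P; apply: no_typeA_exponent4.
move=> odd_or_m N calN; split.
- exact: quotient_U_pgroup p_pr isU.
- exact: quotient_U_critical p_pr isU calN.
- exact: exponent_quotient_U p_pr isU calN.
exact: quotient_U_typeA p_pr isU calN odd_or_m.
Qed.
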